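(* Let $X$ be a Lindelöf Hausdorff pseudoradial space. Then $t(X) = F(X)$.
   Context: A space is Lindelöf if every open cover has a countable subcover (no regularity is assumed). A transfinite sequence $\{x_\alpha : \alpha < \kappa\}$ ($\kappa$ an infinite cardinal) converges to a point $x$ if every open neighbourhood of $x$ contains $\{x_\alpha : \beta \leq \alpha < \kappa\}$ for some $\beta < \kappa$. A topological space $X$ is pseudoradial if for every non-closed set $A \subset X$ there are a point $x \in \overline{A} \setminus A$ and a transfinite sequence $\{x_\alpha : \alpha < \kappa\} \subset A$ which converges to $x$. A sequence $\{x_\alpha : \alpha < \kappa\}$ in $X$ is free if $\overline{\{x_\alpha : \alpha < \beta\}} \cap \overline{\{x_\alpha : \beta \leq \alpha < \kappa\}} = \emptyset$ for every $\beta < \kappa$. $F(X)$ is the supremum of the cardinalities of free sequences in $X$. The tightness $t(X)$ is the least infinite cardinal $\kappa$ such that whenever $A \subset X$ and $x \in \overline{A}$ there is $B \subset A$ with $|B| \leq \kappa$ and $x \in \overline{B}$. As is standard, all cardinal functions are taken to be infinite (so $F(X)$ means $\max\{\omega, F(X)\}$). *)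

(* Defs.v *)
From mathcomp Require Import all_boot.
From mathcomp Require Import boolp classical_sets functions cardinality.
From mathcomp Require Import wochoice.
From mathcomp Require Import topology.

Set Implicit Arguments.
Unset Strict Implicit.
Unset Printing Implicit Defensive.

Local Open Scope classical_set_scope.
Local Open Scope card_scope.

(* Cardinals are represented by types, compared by [#<=] and identified when
   [#=].  The least cardinal satisfying [P] is thus only unique up to [#=] and is
   obtained by choice; the default value [nat] is only reached when no type
   satisfies [P] (see [least_cardP]). *)
Definition is_least_card (P : Type -> Prop) (K : Type) : Prop :=
  P K /\ forall L : Type, P L -> [set: K] #<= [set: L].

Definition least_card (P : Type -> Prop) : Type :=
  match pselect (exists K, is_least_card P K) with
  | left e => sval (cid e)
  | right _ => nat
  end.

Lemma card_leTP (T U : Type) :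
  [set: T] #<= [set: U] <-> exists f : T -> U, injective f.
Proof.
split=> [|[f finj]].
  move=> /card_leP/injfunPex[f _ finj].
  pose inT (x : T) : [set: T] := SigSub (mem_set (I : [set: T] x)).
  exists (fun x => val (f (inT x))) => x y /val_inj fxy.
  exact: (congr1 val (finj _ _ (in_setT _) (in_setT _) fxy)).
have /injfunPex[g] : exists2 f : T -> U, set_fun [set: T] [set: U] f &
    set_inj [set: T] f by exists f => // x y _ _ /finj.
exact: inj_card_le.
Qed.

(* A maximal subset of the product, among those whose projections are all
   injective, projects onto some factor. *)
Lemma card_min_family (J : Type) (K : J -> Type) (j0 : J) :
  exists j, forall i, [set: K j] #<= [set: K i].
Proof.
have [[j Kj0]|ne] := pselect (exists j, K j -> False).
  exists j => i; apply/card_leTP.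
  by exists (fun k => match Kj0 k with end) => k; case: (Kj0 k).
pose T := forall j : J, K j.
have [A [Ainj Amax]] : exists A : set T,
    (forall j s t, A s -> A t -> s j = t j -> s = t) /\
    forall B, A `<` B -> ~ (forall j s t, B s -> B t -> s j = t j -> s = t).
  apply: (@Zorn_bigcup T
    [set A | forall j s t, A s -> A t -> s j = t j -> s = t]) => F FP Ftot j s t.
  move=> [X FX Xs] [Y FY Yt]; have [XY|YX] := Ftot _ _ FX FY.
    by apply: (FP _ FY) => //; apply: XY.
  by apply: (FP _ FX) => //; apply: YX.
have [j Aj] : exists j : J, forall k : K j, exists s, A s /\ s j = k.
  apply: contrapT => /forallNP nj.
  have miss (j : J) : exists k : K j, forall s, A s -> s j <> k.
    have /existsNP[k /forallNP kP] := nj j.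
    by exists k => s As sk; apply: (kP s).
  pose t : T := fun j => sval (cid (miss j)).
  have tP j s : A s -> s j <> t j by move=> As; apply: (svalP (cid (miss j))).
  apply: (Amax (A `|` [set t])).
    split=> [|/(_ t (or_intror erefl)) At]; first by move=> s; left.
    exact: (tP j0 t At erefl).
  move=> j s u [As|->] [Au|->] //; first exact: Ainj.
    by move=> /(tP _ _ As).
  by move=> /esym /(tP _ _ Au).
exists j => i; apply/card_leTP; have /choice[f fP] := Aj.
exists (fun k => f k i) => k l e.
have [[Ak <-] [Al <-]] := (fP k, fP l).
by rewrite (Ainj _ _ _ Ak Al e).
Qed.

Lemma card_le_total (K L : Type) :
  [set: K] #<= [set: L] \/ [set: L] #<= [set: K].
Proof.
have [[] le] := card_min_family (fun b : bool => if b then K else L) true.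
  by left; apply: (le false).
by right; apply: (le true).
Qed.

Lemma least_cardP (P : Type -> Prop) :
  (exists K, P K) -> is_least_card P (least_card P).
Proof.
move=> [K0 PK0]; rewrite /least_card; case: pselect => [e|]; first by case: cid.
case; pose J := {S : set K0 | exists2 K, P K & [set: K] #= S}.
have jK0 : J by exists [set: K0]; exists K0.
have [[S [K PK KS]] /= Smin] := card_min_family (fun j : J => set_type (sval j)) jK0.
have {}Smin (B : set K0) (L : Type) : P L -> [set: L] #= B -> [set: K] #<= [set: L].
  move=> PL LB; have := Smin (exist _ B (ex_intro2 _ _ L PL LB)) => /= SB.
  rewrite (card_le_eql KS) (card_le_eqr LB).
  have [f finj] := (card_leTP _ _).1 SB.
  by apply/card_leP/injfunPex; exists f => // x y _ _ /finj.
exists K; split=> // L PL.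
have [K0L|/card_leTP[f finj]] := card_le_total K0 L.
  by apply: card_le_trans K0L; apply: (Smin [set: K0]).
apply: (Smin (f @` [set: L])) => //.
by rewrite card_eq_sym; apply: inj_card_eq => x y _ _ /finj.
Qed.

Section CardinalSequences.
Variables (K : Type) (le : rel K).

Definition segment (b : K) : set K := [set a | le a b /\ a <> b].

Definition final_segment (b : K) : set K := [set a | le b a].

(* [le] makes [K] a von Neumann cardinal, i.e. an initial ordinal: it is a
   well-order whose proper initial segments are all smaller than [K]. *)
Definition cardinal_order : Prop :=
  well_order le /\ forall b, ~ ([set: K] #<= segment b).

Variable X : topologicalType.

Definition seq_converges (s : K -> X) (x : X) : Prop :=
  forall U : set X, open U -> U x ->
    exists b : K, forall a, final_segment b a -> U (s a).

Definition free_sequence (s : K -> X) : Prop :=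
  forall b : K,
    closure (s @` segment b) `&` closure (s @` final_segment b) = set0.

End CardinalSequences.

Definition lindelof (X : topologicalType) : Prop :=
  forall F : set (set X), (forall U, F U -> open U) ->
    \bigcup_(U in F) U = [set: X] ->
    exists G : set (set X),
      [/\ G `<=` F, countable G & \bigcup_(U in G) U = [set: X]].

Definition pseudoradial (X : topologicalType) : Prop :=
  forall A : set X, ~ closed A ->
    exists x : X, (closure A `\` A) x /\
      exists (K : Type) (le : rel K) (s : K -> X),
        [/\ infinite_set [set: K], cardinal_order le,
            (forall a, A (s a)) & seq_converges le s x].

Definition tightness_bound (X : topologicalType) (K : Type) : Prop :=
  infinite_set [set: K] /\
  forall (A : set X) (x : X), closure A x ->
    exists B : set X, [/\ B `<=` A, B #<= [set: K] & closure B x].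

Definition tightness (X : topologicalType) : Type :=
  least_card (tightness_bound X).

Definition free_bound (X : topologicalType) (K : Type) : Prop :=
  infinite_set [set: K] /\
  forall (L : Type) (le : rel L) (s : L -> X),
    cardinal_order le -> free_sequence le s -> range s #<= [set: K].

(* The least infinite upper bound, i.e. the maximum of [nat] and the supremum of
   the cardinalities of the free sequences. *)
Definition free_number (X : topologicalType) : Type :=
  least_card (free_bound X).

Lemma infinite_sum_nat (T : Type) : infinite_set [set: T + nat].
Proof. by apply/infiniteP/card_leTP; exists inr => m n []. Qed.

Lemma card_le_sum_nat (T : Type) (A : set T) : A #<= [set: T + nat].
Proof.
apply: card_le_trans (subset_card_le (@subsetT _ A)) _.
by apply/card_leTP; exists inl => x y [].
Qed.

Lemma tightnessP (X : topologicalType) :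
  is_least_card (tightness_bound X) (tightness X).
Proof.
apply: least_cardP; exists (X + nat)%type; split; first exact: infinite_sum_nat.
by move=> A x Ax; exists A; split=> //; exact: card_le_sum_nat.
Qed.

Lemma free_numberP (X : topologicalType) :
  is_least_card (free_bound X) (free_number X).
Proof.
apply: least_cardP; exists (X + nat)%type; split; first exact: infinite_sum_nat.
by move=> *; exact: card_le_sum_nat.
Qed.

(* Main.v *)
Require Import Defs.
From mathcomp Require Import all_boot boolp classical_sets functions cardinality.
From mathcomp Require Import wochoice topology.

(** Write [T+] for the successor cardinal of an infinite type [T].

    Free sequences are no longer than the tightness, in a Lindelof
    space: if [T] bounds the tightness and a free sequence is longer than [T],
    restrict it to length [T+].  As [T+] is regular and uncountable, the Lindelof
    property yields a point [x] in the closure of every tail.  By tightness [x] is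
    in the closure of at most [T] terms, which by regularity lie in a proper
    initial segment, and the closures of that segment and of the complementary
    tail are not disjoint.  This is [tightness_bound_free].

    Conversely, suppose that [T] bounds the free sequences and that the closure of
    some [A] has a point that no subset of [A] of size at most [T] accounts for.
    The set [small_closure T A] of the points accounted for is then not closed, so
    a transfinite sequence [s] in it converges to a point [x] outside.  A set of at
    most [T] terms of [s] has its closure inside [small_closure T A], hence away
    from [x]; by the Hausdorff property each point of that closure has an open
    neighbourhood missing a tail of [s], and by the Lindelof property the whole
    closure is separated from a single tail ([separate_tail]): countably many
    tails contain a common one, because no cofinal set of indices has size at most
    [T], and an open set disjoint from a tail is disjoint from its closure.  A
    recursion of length [T+] along such tails produces a free sequence of length
    [T+]: this is [free_bound_tightness].

    The cardinal arithmetic behind both halves is [T * T = T] ([card_square]) and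
    its consequence that a union of at most [T] sets of size at most [T] has size
    at most [T] ([card_le_bigcup]). *)

Local Open Scope classical_set_scope.
Local Open Scope card_scope.

(** * Cardinal arithmetic *)

Lemma card_le_injP {U T : Type} (t0 : T) (A : set U) :
  A #<= [set: T] <-> exists f : U -> T, set_inj A f.
Proof.
split=> [|[f finj]]; last first.
  by rewrite -(card_le_eql (inj_card_eq finj)); exact: subset_card_le.
rewrite -(card_le_eql (card_setT A)) => /card_leTP[f finj].
exists (fun u => if pselect (A u) is left Au then f (SigSub (mem_set Au)) else t0).
move=> u v /set_mem Au /set_mem Av; case: pselect => // Au'; case: pselect => // Av'.
by move=> /finj [].
Qed.

Lemma card_le_setP {U : Type} {A B : set U} : B !=set0 ->
  A #<= B -> exists2 f : U -> U, set_inj A f & forall a, A a -> B (f a).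
Proof.
move=> [b0 Bb0]; rewrite -(card_le_eqr (card_setT B)).
move=> /(card_le_injP (SigSub (mem_set Bb0))) [f finj].
exists (fun u => val (f u)); last by move=> a _; apply: set_valP.
by move=> u v Au Av /val_inj; apply: finj.
Qed.

Section Square.
Variable T : Type.
Implicit Type G : set ((T * T) * T).

Definition square_dom G : set T := [set a | exists c, G ((a, a), c)].

(** The graph of an injection from [D * D] to [D], where [D] can be read off
    the graph as its diagonal: such graphs are closed under unions of chains,
    every clause involving at most two of their points. *)
Definition square_graph G : Prop :=
  [/\ forall p c c', G (p, c) -> G (p, c') -> c = c',
      forall p p' c, G (p, c) -> G (p', c) -> p = p',
      forall a b, square_dom G a -> square_dom G b -> exists c, G ((a, b), c) &
      forall a b c, G ((a, b), c) ->
        [/\ square_dom G a, square_dom G b & square_dom G c]].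

Lemma square_graph_chain G0 (F : set (set ((T * T) * T))) :
  square_graph G0 -> (forall G, F G -> square_graph (G0 `|` G)) ->
  total_on F subset -> square_graph (G0 `|` \bigcup_(G in F) G).
Proof.
move=> G0P FP Ftot; set H := _ `|` _.
have two u v : H u -> H v ->
    exists G, [/\ square_graph G, G `<=` H, G u & G v].
  have H0 : G0 `<=` H by move=> w ?; left.
  have HF G : F G -> G0 `|` G `<=` H.
    by move=> FG w [|Gw]; [left|right; exists G].
  move=> [G0u|[G FG Gu]] [G0v|[G' FG' Gv]].
  - by exists G0.
  - by exists (G0 `|` G'); split; [exact: FP|exact: HF|left|right].
  - by exists (G0 `|` G); split; [exact: FP|exact: HF|right|left].
  - have [GG|GG] := Ftot _ _ FG FG'.
      by exists (G0 `|` G'); split; [exact: FP|exact: HF|right; apply: GG|right].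
    by exists (G0 `|` G); split; [exact: FP|exact: HF|right|right; apply: GG].
split.
- move=> p c c' Hc Hc'; have [G [[+ _ _ _] _ Gc Gc']] := two _ _ Hc Hc'.
  by apply; eauto.
- move=> p p' c Hc Hc'; have [G [[_ + _ _] _ Gc Gc']] := two _ _ Hc Hc'.
  by apply; eauto.
- move=> a b [c Hc] [c' Hc']; have [G [[_ _ + _] GH Gc Gc']] := two _ _ Hc Hc'.
  move=> /(_ a b) [||d Gd]; [by exists c|by exists c'|].
  by exists d; apply: GH.
- move=> a b c Hc; have [G [[_ _ _ +] GH Gc _]] := two _ _ Hc Hc.
  by move=> /(_ _ _ _ Gc) [[x ?] [y ?] [z ?]]; split;
    [exists x|exists y|exists z]; apply: GH.
Qed.

(** Hessenberg's theorem.  For a maximal square graph with domain [D], if the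
    complement of [D] were at least as large as [D], it would contain a copy [E]
    of [D], and [(D `|` E)] squared minus [D] squared would inject into [E],
    extending the graph.  So the complement of [D] injects into [D], whence the
    whole type does. *)
Lemma card_square : infinite_set [set: T] -> [set: T * T] #<= [set: T].
Proof.
move=> /infiniteP/card_leTP[h hinj].
have /card_eqPle[/card_leTP[g ginj] _] := card_nat2.
pose G0 : set ((T * T) * T) :=
  [set w | exists m n, w = ((h m, h n), h (g (m, n)))].
have G0P : square_graph G0.
  have dom n : square_dom G0 (h n) by exists (h (g (n, n))), n, n.
  split.
  - by move=> p c c' [m [n [-> ->]]] [m' [n' [/hinj-> /hinj-> ->]]].
  - move=> p p' c [m [n [-> ->]]] [m' [n' [-> /hinj/ginj]]].
    by move=> [-> ->].
  - move=> a b [c [m [n [-> _ _]]]] [c' [m' [n' [-> _ _]]]].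
    by exists (h (g (m, m'))), m, m'.
  - by move=> a b c [m [n [-> -> ->]]].
have [G [GP Gmax]] := @Zorn_bigcup _ [set G | square_graph (G0 `|` G)]
  (fun F FP Ftot => @square_graph_chain G0 F G0P FP Ftot).
set H := G0 `|` G in GP.
have {Gmax} Hmax H' : H `<=` H' -> square_graph H' -> H' `<=` H.
  move=> HH' H'P w H'w; apply: contrapT => nHw; apply: (Gmax H').
    split; first by move=> u Gu; apply: HH'; right.
    by move=> /(_ w H'w) Gw; apply: nHw; right.
  rewrite /= (_ : G0 `|` H' = H') //.
  by apply/seteqP; split=> [u [G0u|//]|u]; [apply: HH'; left|right].
have [Hfun Hinj Htot Hdom] := GP.
set D := square_dom H in Htot Hdom.
have Dh n : D (h n) by exists (h (g (n, n))); left; exists n, n.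
have /choice[f fP] (p : T * T) : exists c, D p.1 -> D p.2 -> H (p, c).
  case: p => a b /=.
  have [[Da Db]|nD] := pselect (D a /\ D b).
    by have [c Hc] := Htot _ _ Da Db; exists c.
  by exists a => Da Db; case: nD.
have fD p : D p.1 -> D p.2 -> D (f p).
  by case: p => a b Da Db; have [] := Hdom _ _ _ (fP (a, b) Da Db).
have finj p q : D p.1 -> D p.2 -> D q.1 -> D q.2 -> f p = f q -> p = q.
  move=> Dp1 Dp2 Dq1 Dq2 e; apply: (Hinj p q (f p)); first exact: fP.
  by rewrite e; exact: fP.
have h01 : h 0 <> h 1 by move=> /hinj.
(* [D] and a set [E] of size at most that of [D] fit together into [D], through
   the codes [f] gives to the pairs with first entry [h 0] and [h 1]. *)
have twice (j : T -> T) (E : set T) : set_inj E j -> (forall a, E a -> D (j a)) ->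
    (forall a, E a -> ~ D a) ->
    exists e, (forall a, (D `|` E) a -> D (e a)) /\ set_inj (D `|` E) e.
  move=> jinj jD ED.
  exists (fun a => if pselect (D a) is left _ then f (h 0, a) else f (h 1, j a)).
  split=> [a [] Ha|a b /set_mem Ha /set_mem Hb].
  - by case: pselect => // _; apply: fD => /=.
  - by case: pselect => [/(ED _ Ha)|_] //; apply: fD => /=; auto.
  case: pselect => Da; case: pselect => Db.
  - by move=> /finj /= /(_ (Dh _) Da (Dh _) Db) [].
  - have Eb : E b by case: Hb.
    by move=> /finj /= /(_ (Dh _) Da (Dh _) (jD _ Eb)) [].
  - have Ea : E a by case: Ha.
    by move=> /finj /= /(_ (Dh _) (jD _ Ea) (Dh _) Db) [/esym].
  - have Ea : E a by case: Ha.
    have Eb : E b by case: Hb.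
    move=> /finj /= /(_ (Dh _) (jD _ Ea) (Dh _) (jD _ Eb)) [].
    by apply: jinj; apply: mem_set.
have DN0 : D !=set0 by exists (h 0).
have [CD|DC] : (~` D #<= D) \/ (D #<= ~` D).
  rewrite -(card_le_eql (card_setT D)) -(card_le_eqr (card_setT D)).
  rewrite -(card_le_eql (card_setT (~` D))) -(card_le_eqr (card_setT (~` D))).
  by have [] := card_le_total (set_type D) (set_type (~` D)); [right|left].
  have [j jinj jD] := card_le_setP DN0 CD.
  have [e [eD einj]] := twice j (~` D) jinj jD (fun _ => id).
  rewrite setUv in eD einj.
  apply/card_leTP; exists (fun p => f (e p.1, e p.2)) => -[a b] [c d] /=.
  have {}eD x : D (e x) by apply: eD.
  have {}einj : injective e by move=> x y; apply: einj; apply: mem_set.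
  by move=> /finj /= /(_ (eD _) (eD _) (eD _) (eD _)) [/einj-> /einj->].
have [a0 nDa0] : ~` D !=set0.
  apply: contrapT => /set0P/negP/negPn/eqP C0.
  by move: DC; rewrite C0 card_le0 => /eqP D0; move: (Dh 0); rewrite D0.
have [i iinj iD] := card_le_setP (ex_intro _ a0 nDa0) DC.
pose E := i @` D.
have /choice[j jP] (a : T) : exists b, E a -> D b /\ i b = a.
  have [[b Db ib]|nE] := pselect (E a); first by exists b.
  by exists a.
have ED a : E a -> ~ D a by move=> [b Db <-]; apply: iD.
have jinj : set_inj E j.
  by move=> x y /set_mem/jP[_ jx] /set_mem/jP[_ jy] jxy; rewrite -jx -jy jxy.
have jD x : E x -> D (j x) by move=> /jP[].
have [e [eD einj]] := twice j E jinj jD ED.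
(* The old values lie in [D] and the new ones in its copy [E], so the extended
   graph is still injective. *)
pose new (w : (T * T) * T) := [/\ (D `|` E) w.1.1, (D `|` E) w.1.2,
  ~ (D w.1.1 /\ D w.1.2) & w.2 = i (f (e w.1.1, e w.1.2))].
have newE w : new w -> E w.2.
  case: w => -[a b] c [/= aD bD _ ->]; exists (f (e a, e b)) => //.
  by apply: fD => /=; apply: eD.
have ndom a : (D `|` E) a -> square_dom (H `|` new) a.
  move=> [[c Hc]|Ea]; first by exists c; left.
  exists (i (f (e a, e a))); right; split=> //=; try by right.
  by move=> [/(ED _ Ea)].
have domn a : square_dom (H `|` new) a -> (D `|` E) a.
  by move=> [c [Hc|[]//]]; left; exists c.
have Hw w : H w -> [/\ D w.1.1, D w.1.2 & D w.2].
  by case: w => -[a b] c /Hdom.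
have HnewP : square_graph (H `|` new).
  split.
  - move=> p c c' [Hc|nc] [Hc'|nc'].
    + exact: Hfun Hc Hc'.
    + by case: nc' => _ _ []; have [] := Hw _ Hc.
    + by case: nc => _ _ []; have [] := Hw _ Hc'.
    + by case: nc => _ _ _ /= ->; case: nc' => _ _ _ /= ->.
  - move=> p p' c [Hc|nc] [Hc'|nc'].
    + exact: Hinj Hc Hc'.
    + by have [_ _ Dc] := Hw _ Hc; have /ED := newE _ nc'.
    + by have [_ _ Dc] := Hw _ Hc'; have /ED := newE _ nc.
    + case: p p' nc nc' => a b [a' b'] [/= Da Db _ ->] [/= Da' Db' _].
      have De2 x y : (D `|` E) x -> (D `|` E) y -> D (f (e x, e y)).
        by move=> Hx Hy; apply: fD => /=; apply: eD.
      move=> /iinj; rewrite !inE => /(_ (De2 _ _ Da Db) (De2 _ _ Da' Db')).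
      move=> /finj /= /(_ (eD _ Da) (eD _ Db) (eD _ Da') (eD _ Db')) [].
      by move=> /einj; rewrite !inE => -> // /einj; rewrite !inE => ->.
  - move=> a b /domn Da /domn Db.
    have [[Da' Db']|nD] := pselect (D a /\ D b).
      by have [c Hc] := Htot _ _ Da' Db'; exists c; left.
    by exists (i (f (e a, e b))); right.
  - move=> a b c [/Hdom[Da Db Dc]|nc].
      by split; apply: ndom; left.
    have Ec := newE _ nc; case: nc => /= Da Db _ _.
    by split; apply: ndom => //; right.
have Ei : E (i (h 0)) by exists (h 0).
case: (ED _ Ei); have [c Hc] := ndom _ (or_intror Ei).
exists c; apply: (Hmax _ _ HnewP) => //.
Qed.

End Square.

(** An element of the union is coded by the index of a member containing it and
    its code within that member. *)
Lemma card_le_bigcup {I U T : Type} (J : set I) (F : I -> set U) :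
  infinite_set [set: T] -> J #<= [set: T] -> (forall j, J j -> F j #<= [set: T]) ->
  \bigcup_(j in J) F j #<= [set: T].
Proof.
move=> Tinf JT FT; have [t0 _] := infinite_setN0 Tinf.
apply: card_le_trans (card_square _ Tinf).
have [f finj] := (card_le_injP t0 J).1 JT.
have /choice[g gP] (j : I) : exists g : U -> T, J j -> set_inj (F j) g.
  have [Jj|nJj] := pselect (J j); last by exists (fun=> t0).
  by have [g ginj] := (card_le_injP t0 (F j)).1 (FT j Jj); exists g.
have /choice[i iP] (u : U) :
    exists p : T * T, (\bigcup_(j in J) F j) u ->
      exists j, [/\ J j, F j u & p = (f j, g j u)].
  have [[j Jj Fu]|nu] := pselect ((\bigcup_(j in J) F j) u).
    by exists (f j, g j u) => _; exists j.
  by exists (t0, t0).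
apply/(card_le_injP (t0, t0)); exists i => u v /set_mem/iP[j [Jj Fu ->]].
move=> /set_mem/iP[k [Jk Fv ->]] [/finj jk].
rewrite -jk ?inE// in Fv *.
by apply: gP; rewrite ?inE.
Qed.

Lemma card_le_setU {U T : Type} (A B : set U) : infinite_set [set: T] ->
  A #<= [set: T] -> B #<= [set: T] -> A `|` B #<= [set: T].
Proof.
move=> Tinf AT BT; rewrite -bigcup2E.
apply: card_le_bigcup => //; first exact/infiniteP.
by move=> [|[|n]] _ //=; exact: card_ge0.
Qed.

Lemma card_le_set1 {U T : Type} (u : U) : infinite_set [set: T] ->
  [set u] #<= [set: T].
Proof.
by move=> /infiniteP; apply: card_le_trans; exact: countable1.
Qed.

(** * Well-orders *)

Section WellOrder.
Variables (K : Type) (le : rel K).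
Hypothesis wo : well_order le.

Lemma wo_min (A : set K) : A !=set0 -> exists2 m, A m & forall a, A a -> le m a.
Proof.
move=> [a Aa]; have [|m [[/set_mem Am mP] _]] := wo (mem A).
  by exists a; apply: mem_set.
by exists m => // b Ab; apply: mP; apply: mem_set.
Qed.

Lemma wo_refl a : le a a.
Proof. by have [|b -> ] := wo_min [set a]; [exists a|apply]. Qed.

Lemma wo_total a b : le a b || le b a.
Proof.
have [|c [->|->] cP] := wo_min [set a; b]; first by exists a; left.
  by rewrite cP//; right.
by rewrite (cP a) ?orbT//; left.
Qed.

Lemma wo_anti a b : le a b -> le b a -> a = b.
Proof.
move=> ab ba; have [|c [_ cP]] := wo (mem [set a; b]).
  by exists a; apply: mem_set; left.
have ca : c = a.
  by apply: cP; split=> [|d /set_mem [->|->]] //; [apply: mem_set; left|exact: wo_refl].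
rewrite -ca; apply: cP; split=> [|d /set_mem [->|->]] //; last exact: wo_refl.
by apply: mem_set; right.
Qed.

Lemma wo_trans a b c : le a b -> le b c -> le a c.
Proof.
move=> ab bc; have [|d] := wo_min ([set a; b] `|` [set c]); first by exists a; left; left.
move=> [[->|->]|->] dP.
- by apply: dP; right.
- have ba : le b a by apply: dP; left; left.
  by rewrite (wo_anti _ _ ab ba).
- have cb : le c b by apply: dP; left; right.
  by rewrite -(wo_anti _ _ bc cb).
Qed.

Lemma segmentVfinal a b : segment le b a \/ final_segment le b a.
Proof.
have [ba|nba] := boolP (le b a); first by right.
left; split; first by have := wo_total a b; rewrite (negbTE nba) orbF.
by move=> ab; rewrite ab wo_refl in nba.
Qed.

Lemma segment_final a b : segment le b a -> ~ final_segment le b a.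
Proof. by move=> [ab nab] ba; apply: nab; exact: wo_anti. Qed.

Lemma segment_subset a b : le a b -> segment le a `<=` segment le b.
Proof.
move=> ab c [ca nca]; split; first exact: wo_trans ab.
by move=> cb; apply: nca; apply: wo_anti => //; rewrite cb.
Qed.

Lemma segment_wf : well_founded (fun a b => segment le b a).
Proof.
move=> a; apply: contrapT => na.
have [|m nm mP] := wo_min [set b | ~ Acc (fun a b => segment le b a) b].
  by exists a.
apply: nm; constructor => b mb; apply: contrapT => /mP.
exact: segment_final.
Qed.

(** Transfinite recursion, for a step that only looks at the set of earlier
    values. *)
Lemma segment_rec {V : Type} (phi : set V -> V) :
  exists g : K -> V, forall a, g a = phi (g @` segment le a).
Proof.
pose F a (rec : forall b, segment le a b -> V) :=
  phi [set v | exists b (ba : segment le a b), rec b ba = v].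
exists (Fix segment_wf (fun=> V) F) => a.
rewrite Fix_eq; last first.
  move=> b r r' rr'; congr phi; apply/seteqP.
  by split=> v [c [cb <-]]; exists c, cb.
congr phi; apply/seteqP; split=> v.
  by move=> [b [ba <-]]; exists b.
by move=> [b ba <-]; exists b, ba.
Qed.

(** A well-order larger than [T] contains one of type the successor cardinal of
    [T]: keep the points that have at most [T] predecessors. If some point is
    left out, the least such point has exactly the kept points as predecessors. *)
Lemma succ_cardinal_sub (T : Type) : ~ ([set: K] #<= [set: T]) ->
  exists (L : Type) (i : L -> K) (leL := fun u v => le (i u) (i v)),
    [/\ injective i, cardinal_order leL, ~ ([set: L] #<= [set: T]) &
        forall u, segment leL u #<= [set: T]].
Proof.
move=> KT; pose D := [set k | segment le k #<= [set: T]].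
have DT : ~ (D #<= [set: T]).
  have [DK|/existsNP nD] := pselect (forall k, D k).
    by move=> DT; apply: KT; apply: card_le_trans DT; apply: subset_card_le => k _.
  have [m nDm mP] := wo_min [set k | ~ D k] nD.
  move=> DT; apply: nDm; apply: card_le_trans DT; apply: subset_card_le => k mk.
  by apply: contrapT => /mP; exact: segment_final.
have ninj : injective (set_val : set_type D -> K) by exact: val_inj.
pose leL (u v : set_type D) := le (val u) (val v).
have LT : ~ ([set: set_type D] #<= [set: T]) by rewrite (card_le_eql (card_setT D)).
have segT u : segment leL u #<= [set: T].
  apply: card_le_trans (set_valP u : D _).
  rewrite -(card_le_eql (inj_card_eq (in2W ninj))).
  apply: subset_card_le => k [v [vu nvu] <-]; split=> //.
  by move=> /ninj.
exists (set_type D), set_val; split=> //; split; last first.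
  by move=> u /card_le_trans /(_ (segT u)).
apply: antisymmetric_well_order => [u v /andP[uv vu]|A [a Aa]].
  by apply: ninj; exact: wo_anti.
have [|m [v Av <-] mP] := wo_min (set_val @` [set` A]).
  by exists (val a), a.
by exists v; split=> // w Aw; apply: mP; exists w.
Qed.

(** Regularity of the successor cardinal: the initial segments ending at the
    points of a cofinal [B] would cover [K] by at most [T] sets of size at most
    [T]. *)
Lemma small_bounded (T : Type) (B : set K) : infinite_set [set: T] ->
  ~ ([set: K] #<= [set: T]) -> (forall k, segment le k #<= [set: T]) ->
  B #<= [set: T] -> exists k, B `<=` segment le k.
Proof.
move=> Tinf KT segT BT; apply: contrapT => nB; apply: KT.
have BUT : \bigcup_(b in B) (segment le b `|` [set b]) #<= [set: T].
  apply: card_le_bigcup => // b _.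
  by apply: card_le_setU => //; exact: card_le_set1.
apply: card_le_trans BUT; apply: subset_card_le => k _.
apply: contrapT => nk; apply: nB; exists k => b Bb.
have [//|kb] := segmentVfinal b k; case: nk; exists b => //.
have [->|nkb] := pselect (k = b); first by right.
by left; split.
Qed.

End WellOrder.

(** * Free sequences *)

Section FreeSequence.
Variable X : topologicalType.

Lemma closure_open (A U : set X) (x : X) :
  closure A x -> open U -> U x -> exists2 a, A a & U a.
Proof.
by move=> Ax Uo Ux; have [a [Aa Ua]] := Ax U (open_nbhs_nbhs (conj Uo Ux)); exists a.
Qed.

Lemma closureP (A : set X) (x : X) :
  (forall U, open U -> U x -> exists2 a, A a & U a) -> closure A x.
Proof.
move=> AU V; rewrite nbhsE => -[U [Uo Ux] UV].
by have [a Aa Ua] := AU U Uo Ux; exists a; split=> //; apply: UV.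
Qed.

(** If [a] precedes [b], the definition at [b] separates [s a], a term of the
    initial segment, from [s b], the first term of the tail. *)
Lemma free_sequence_injective (K : Type) (le : rel K) (s : K -> X) :
  well_order le -> free_sequence le s -> injective s.
Proof.
move=> wo sfree.
have sep a b : segment le b a -> s a <> s b.
  move=> ab sab; suff : set0 (s a) by [].
  rewrite -(sfree b); split; apply: subset_closure; first by exists a.
  by exists b => //; exact: wo_refl.
move=> a b sab; apply: contrapT => nab.
have [/sep//|ba] := segmentVfinal _ _ wo a b.
by apply: (@sep b a) => //; split=> // /esym.
Qed.

Lemma free_sequence_sub (K L : Type) (le : rel K) (i : L -> K) (s : K -> X) :
  injective i -> free_sequence le s ->
  free_sequence (fun u v => le (i u) (i v)) (s \o i).
Proof.
move=> iinj sfree u; apply/seteqP; split=> // x [xs xf].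
rewrite -(sfree (i u)); split.
  apply: closureS xs => _ [v [vu nvu] <-]; exists (i v) => //.
  by split=> // /iinj.
by apply: closureS xf => _ [v uv <-]; exists (i v).
Qed.

(** Otherwise the complements of the closed tails form an open cover; a term of
    [s] beyond the indices of a countable subcover lies in no member of it. *)
Lemma lindelof_cofinal_point (K : Type) (le : rel K) (s : K -> X) :
  lindelof X -> well_order le ->
  (forall B : set K, countable B -> exists k, B `<=` segment le k) ->
  exists x, forall k, closure (s @` final_segment le k) x.
Proof.
move=> lind wo bounded; apply: contrapT => /forallNP nx.
pose F k := closure (s @` final_segment le k).
have [||G [GF Gcount Gcover]] := lind [set ~` F k | k in [set: K]].
- by move=> _ [k _ <-]; apply: closed_openC; exact: closed_closure.
- apply/seteqP; split=> // x _; have /existsNP[k nFx] := nx x.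
  by exists (~` F k) => //; exists k.
have [k0 _] : [set: K] !=set0 by have [k _] := bounded _ (countable0 K); exists k.
have /choice[c cP] (U : set X) : exists k, G U -> U = ~` F k.
  have [GU|nGU] := pselect (G U); last by exists k0.
  by have [k _ <-] := GF _ GU; exists k.
have [|k ck] := bounded (c @` G).
  exact: card_le_trans (card_image_le _ _) Gcount.
have [U GU] : (\bigcup_(U in G) U) (s k) by rewrite Gcover.
rewrite (cP U GU); apply; apply: subset_closure; exists k => //.
by have [] : segment le k (c U) by apply: ck; exists U.
Qed.

(** A free sequence longer than [T] has a free subsequence of length the successor
    of [T].  That length is regular, so some [x] is in the closure of every tail; but
    tightness puts [x] in the closure of at most [T] terms, hence in that of a
    proper initial segment. *)
Lemma tightness_bound_free (T : Type) :
  lindelof X -> tightness_bound X T -> free_bound X T.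
Proof.
move=> lind [Tinf tightT]; split=> // K le s [wo _] sfree; apply: contrapT => nsT.
have KT : ~ ([set: K] #<= [set: T]).
  by move=> KT; apply: nsT; apply: card_le_trans KT; exact: card_image_le.
have [L [i [iinj [woL _] LT segT]]] := succ_cardinal_sub _ _ wo _ KT.
move: woL segT; set leL := (X in well_order X) => woL segT.
pose r := s \o i; have rfree : free_sequence leL r by exact: free_sequence_sub.
have bounded B : B #<= [set: T] -> exists u, B `<=` segment leL u.
  exact: small_bounded.
have [x xP] : exists x, forall u, closure (r @` final_segment leL u) x.
  apply: lindelof_cofinal_point => // B Bcount; apply: bounded.
  by apply: card_le_trans Bcount _; apply/infiniteP.
have [u0 _] := bounded _ (card_ge0 _ _).
have [B [Br BT xB]] : exists B, [/\ B `<=` range r, B #<= [set: T] & closure B x].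
  by apply: tightT; apply: closureS (xP u0); exact: image_subset.
have /choice[c cP] (y : X) : exists u, B y -> r u = y.
  have [By|nBy] := pselect (B y); last by exists u0.
  by have [u _ ru] := Br _ By; exists u.
have [|u cu] := bounded (c @` B).
  exact: card_le_trans (card_image_le _ _) BT.
suff : set0 x by [].
rewrite -(rfree u); split=> //; apply: closureS xB => y By.
by exists (c y); [apply: cu; exists y|exact: cP].
Qed.

(** The points reached from [A] by closing its subsets of size at most [T]. *)
Definition small_closure (T : Type) (A : set X) : set X :=
  [set x | exists B : set X, [/\ B `<=` A, B #<= [set: T] & closure B x]].

(** The chosen subsets of [A] accounting for the points of [B] number at most [T],
    so their union is still of size at most [T]. *)
Lemma small_closure_idem (T : Type) (A B : set X) : infinite_set [set: T] ->
  B `<=` small_closure T A -> B #<= [set: T] -> closure B `<=` small_closure T A.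
Proof.
move=> Tinf BA BT x xB.
have /choice[C CP] (b : X) : exists C : set X,
    B b -> [/\ C `<=` A, C #<= [set: T] & closure C b].
  have [Bb|nBb] := pselect (B b); last by exists set0.
  by have [C CP] := BA _ Bb; exists C.
exists (\bigcup_(b in B) C b); split.
- by move=> y [b Bb Cy]; have [CA _ _] := CP _ Bb; apply: CA.
- by apply: card_le_bigcup => // b /CP[].
apply: closureP => U Uo Ux.
have [b Bb Ub] := closure_open _ _ _ xB Uo Ux.
have [_ _ bC] := CP _ Bb; have [y Cy Uy] := closure_open _ _ _ bC Uo Ub.
by exists y => //; exists b.
Qed.

Section ConvergentSequence.
Variables (K : Type) (le : rel K) (s : K -> X) (x : X).
Hypotheses (wo : well_order le) (sx : seq_converges le s x).

(** A cofinal set of indices meets every tail. *)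
Lemma cofinal_closure (B : set K) :
  (forall k, ~ B `<=` segment le k) -> closure (s @` B) x.
Proof.
move=> Bcof; apply: closureP => U Uo Ux; have [k kU] := sx U Uo Ux.
apply: contrapT => nBU; apply: (Bcof k) => b Bb.
have [//|/kU Ub] := segmentVfinal _ _ wo b k.
by case: nBU; exists (s b) => //; exists b.
Qed.

(** Each [y] other than [x] has an open neighbourhood missing some tail of [s];
    countably many of them cover the Lindelof set [closure (s @` B)], and a
    common later tail is missed by their union. *)
Lemma separate_tail (B : set K) : lindelof X -> hausdorff_space X ->
  (forall C : set K, countable C -> exists k, C `<=` segment le k) ->
  ~ closure (s @` B) x ->
  exists k, closure (s @` B) `&` closure (s @` final_segment le k) = set0.
Proof.
move=> lind; rewrite open_hausdorff => haus bounded nBx; pose C := closure (s @` B).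
pose misses (U : set X) k := forall a, final_segment le k a -> ~ U (s a).
have [||G [GF Gcount Gcover]] :=
    lind [set U | open U /\ (U = ~` C \/ exists k, misses U k)].
- by move=> U [].
- apply/seteqP; split=> // y _; have [Cy|nCy] := pselect (C y); last first.
    by exists (~` C) => //; split; [apply: closed_openC; exact: closed_closure|left].
  have [|[U V] /= [/set_mem Uy /set_mem Vx] [Uo Vo /eqP UV0]] := haus y x.
    by apply/eqP => yx; apply: nBx; rewrite -yx.
  exists U => //; split=> //; right; have [k kV] := sx V Vo Vx.
  exists k => a ka Ua; suff : set0 (s a) by [].
  by rewrite -UV0; split=> //; exact: kV.
have [k0 _] := bounded _ (countable0 K).
have /choice[c cP] (U : set X) : exists k, G U -> U = ~` C \/ misses U k.
  have [/GF[_ [->|[k Uk]]]|nGU] := pselect (G U); [by exists k0; left| |by exists k0].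
  by exists k; right.
have [|k ck] := bounded (c @` G).
  exact: card_le_trans (card_image_le _ _) Gcount.
exists k; apply/seteqP; split=> // y [Cy ty].
have [U GU Uy] : (\bigcup_(U in G) U) y by rewrite Gcover.
have [UC|Uk] := cP U GU; first by move: Uy; rewrite UC => /(_ Cy).
have [_ [a ka <-] Ua] := closure_open _ _ _ ty (GF _ GU).1 Uy.
apply: Uk Ua; apply: wo_trans ka => //.
by have [] : segment le k (c U) by apply: ck; exists U.
Qed.

End ConvergentSequence.

(** If [T] did not bound the tightness, some [small_closure T A] would fail to be
    closed, and a sequence [s] in it would converge to a point [x] outside.  No
    subset of the index set of size at most [T] is cofinal, since [x] is not in the
    closure of at most [T] terms of [s].  Hence every set of at most [T] terms has
    a closure disjoint from that of some tail; moving to such a tail at each step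
    of a recursion of length the successor of [T] gives a free sequence. *)
Lemma free_bound_tightness (T : Type) :
  lindelof X -> hausdorff_space X -> pseudoradial X ->
  free_bound X T -> tightness_bound X T.
Proof.
move=> lind haus prad [Tinf freeT]; split=> // A z zA; apply: contrapT => nz.
have [|x [[_ nx] [K [le [s [_ [wo _] sA sx]]]]]] := prad (small_closure T A).
  move=> /closure_id cl; apply: nz.
  suff : small_closure T A z by [].
  rewrite cl; apply: closureS zA => a Aa; exists [set a].
  by split; [move=> _ ->|exact: card_le_set1|apply: subset_closure].
have sB_small (B : set K) : B #<= [set: T] -> ~ closure (s @` B) x.
  move=> BT /(small_closure_idem T A) xA; apply: nx; apply: xA => //.
    by move=> _ [b _ <-]; exact: sA.
  exact: card_le_trans (card_image_le _ _) BT.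
have bounded (B : set K) : B #<= [set: T] -> exists k, B `<=` segment le k.
  move=> BT; apply: contrapT => /forallNP nB; apply: (sB_small B) => //.
  exact: (cofinal_closure _ le _ _ wo sx).
have cbounded (B : set K) : countable B -> exists k, B `<=` segment le k.
  by move=> Bcount; apply: bounded; apply: card_le_trans Bcount _; apply/infiniteP.
have KT : ~ ([set: K] #<= [set: T]).
  by move=> /bounded[k /(_ k I)[_]].
have [k0 _] := bounded _ (card_ge0 _ _).
have /choice[phi phiP] (S : set K) : exists k, S #<= [set: T] ->
    S `<=` segment le k /\
    closure (s @` S) `&` closure (s @` final_segment le k) = set0.
  have [ST|nST] := pselect (S #<= [set: T]); last by exists k0.
  have [k1 Sk1] := bounded _ ST.
  have [k2 disj] := separate_tail _ _ _ _ wo sx _ lind haus cbounded (sB_small _ ST).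
  have [k kP] : exists k, le k1 k /\ le k2 k.
    have [k12|k21] := orP (wo_total _ _ wo k1 k2).
      by exists k2; split=> //; exact: wo_refl.
    by exists k1; split=> //; exact: wo_refl.
  exists k => _; split.
    exact: subset_trans Sk1 (segment_subset _ _ wo _ _ kP.1).
  apply/seteqP; split=> // y [yS yk]; rewrite -disj; split=> //.
  apply: closureS yk; apply: image_subset => a ka.
  exact: (wo_trans _ _ wo _ _ _ kP.2 ka).
have [L [i [iinj cardL LT segT]]] := succ_cardinal_sub _ _ wo _ KT.
move: cardL segT; set leL := (X in cardinal_order X) => cardL segT.
have woL := cardL.1; have [g gE] := segment_rec _ _ woL phi.
have gP u : g @` segment leL u `<=` segment le (g u) /\
    closure (s @` (g @` segment leL u)) `&`
    closure (s @` final_segment le (g u)) = set0.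
  rewrite [g u]gE; apply: phiP.
  exact: card_le_trans (card_image_le _ _) (segT u).
have gmono u v : leL u v -> le (g u) (g v).
  have [-> _|uv luv] := pselect (u = v); first exact: wo_refl.
  by have [] : segment le (g v) (g u) by apply: (gP v).1; exists u.
have free : free_sequence leL (s \o g).
  move=> u; apply/seteqP; split=> // y [ys yf].
  rewrite -(gP u).2 image_comp; split=> //; apply: closureS yf.
  by move=> _ [v /gmono uv <-]; exists (g v).
apply: LT; apply: card_le_trans (freeT _ _ _ cardL free).
have sginj := free_sequence_injective _ _ _ woL free.
by rewrite (card_le_eqr (inj_card_eq (in2W sginj))).
Qed.

End FreeSequence.

Theorem corollary3 (X : topologicalType) :
  lindelof X -> hausdorff_space X -> pseudoradial X ->
  [set: tightness X] #= [set: free_number X].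
Proof.
move=> lind haus prad.
have [tX tmin] := tightnessP X; have [fX fmin] := free_numberP X.
apply/card_eqPle; split.
  by apply: tmin; exact: free_bound_tightness.
by apply: fmin; exact: tightness_bound_free.
Qed.
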